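(* Let $\Lambda$ be a domestic string algebra, let $\mathfrak x_0$ be a string for $\Lambda$, and let $i\in\{1,-1\}$. Then the linear order $(H_l^i(\mathfrak x_0),<_l)$ belongs to $\mathrm{dLO}_{\mathrm{fp}}^{\mathrm b}$, the class of finitely presented bounded discrete linear orders.
   Context: **String algebras.** $\mathcal K$ is an algebraically closed field. A string algebra is $\Lambda=\mathcal KQ/\langle\rho\rangle$, finite dimensional, where $Q$ is a finite quiver and $\rho$ is a set of monomial relations (paths of length at least $2$), such that: each vertex is the source of at most two arrows and the target of at most two arrows; for each arrow $b$ there is at most one arrow $a$ such that $ab$ is a path not in $\langle\rho\rangle$ and at most one arrow $c$ such that $bc$ is a path not in $\langle\rho\rangle$. Paths are composed from right to left: $ab$ means first $b$, then $a$. **Strings.** A syllable is an arrow (direct syllable) or the formal inverse of an arrow (inverse syllable; source and target are interchanged). A string of positive length $n$ is a word $\alpha_n\cdots\alpha_1$ of syllables such that the target of $\alpha_k$ is the source of $\alpha_{k+1}$, $\alpha_{k+1}\neq\alpha_k^{-1}$, and no subword $w$ satisfies $w\in\rho$ or $w^{-1}\in\rho$. The first syllable is the rightmost one $\alpha_1$. Fix functions $\sigma,\varepsilon:Q_1\to\{1,-1\}$ with $\sigma(\alpha)=-\sigma(\alpha')$ for distinct arrows with the same source, $\varepsilon(\beta)=-\varepsilon(\beta')$ for distinct arrows with the same target, and $\sigma(\alpha)=-\varepsilon(\beta)$ whenever $\alpha\beta$ is a path of length $2$ not in $\rho$; extend them by $\sigma(\alpha^{-1})=\varepsilon(\alpha)$,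 $\varepsilon(\alpha^{-1})=\sigma(\alpha)$. For each vertex $v$ there are two strings of length $0$, $1_{(v,1)}$ and $1_{(v,-1)}$; a string $\mathfrak x$ of positive length starting at $v$ has $1_{(v,j)}$ as a left substring iff its first syllable $\alpha$ satisfies $\sigma(\alpha)=-j$. The length of $\mathfrak x$ is $|\mathfrak x|$. If $\mathfrak x=\mathfrak z\mathfrak y$ then $\mathfrak y$ is a left substring of $\mathfrak x$. **Bands and domesticity.** A band is a string $\mathfrak b$ of positive length such that $\mathfrak b^n$ is a string for all $n\ge1$ and $\mathfrak b$ is not a proper power of another string; bands are considered up to cyclic permutation. $\Lambda$ is domestic if it has only finitely many bands. **Hammocks.** $H_l(\mathfrak x_0)$ is the set of all strings having $\mathfrak x_0$ as a left substring. For distinct $\mathfrak x,\mathfrak y\in H_l(\mathfrak x_0)$ put $\mathfrak x<_l\mathfrak y$ if one of the following holds: $\mathfrak y=\mathfrak z\alpha\mathfrak x$ with $\alpha$ an inverse syllable; $\mathfrak x=\mathfrak z\beta\mathfrak y$ with $\beta$ a direct syllable; $\mathfrak x=\mathfrak z\beta\mathfrak w$ and $\mathfrak y=\mathfrak z'\alpha\mathfrak w$ with $\mathfrak w\in H_l(\mathfrak x_0)$, $\beta$ a direct syllable and $\alpha$ an inverse syllable. This is a linear order with a maximum $\mathfrak m_1(\mathfrak x_0)$ (the longest string obtained from $\mathfrak x_0$ by adding only inverse syllables on the left) and a minimum $\mathfrak m_{-1}(\mathfrak x_0)$ (the longest string obtained from $\mathfrak x_0$ by adding only direct syllables on the left).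 Set $H_l^1(\mathfrak x_0):=[\mathfrak x_0,\mathfrak m_1(\mathfrak x_0)]$ and $H_l^{-1}(\mathfrak x_0):=[\mathfrak m_{-1}(\mathfrak x_0),\mathfrak x_0]$, closed intervals in $(H_l(\mathfrak x_0),<_l)$. **Finitely presented linear orders.** $\mathrm{LO}_{\mathrm{fp}}$ is the smallest class of linear orders, closed under isomorphism, that contains the one-element order $\mathbf 1$ and is closed under $L,L'\mapsto L+L'$, $L\mapsto\omega\times L$ and $L\mapsto\omega^*\times L$, where $\omega\times L$ (resp. $\omega^*\times L$) is the sum of copies of $L$ indexed by $\omega$ (resp. by the reverse $\omega^*$ of $\omega$). A linear order is bounded if it has a minimum and a maximum, and discrete if every non-maximal element has an immediate successor and every non-minimal element has an immediate predecessor. $\mathrm{dLO}_{\mathrm{fp}}^{\mathrm b}$ is the subclass of bounded discrete members of $\mathrm{LO}_{\mathrm{fp}}$. *)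

(* Defs.v *)
From HB Require Import structures.
From mathcomp Require Import all_boot all_order all_algebra finmap.
From mathcomp.multinomials Require Import monalg.

Set Implicit Arguments.
Unset Strict Implicit.
Unset Printing Implicit Defensive.

Import GRing.Theory.
Local Open Scope ring_scope.

(* Paths and words compose from right to left and are stored as written: the
   word a_n ... a_1 is [:: a_n; ...; a_1], so its first letter a_1 is the last
   item of the sequence and the product zy is z ++ y.
   The signs 1 and -1 are the booleans true and false; negation is ~~. *)

Record quiver := Quiver {
  vert : finType;
  arr : finType;
  src : arr -> vert;
  tgt : arr -> vert }.

Section PathAlgebra.
Variable Q : quiver.

Definition walk_tgt (v : vert Q) (w : seq (arr Q)) : vert Q :=
  if w is a :: _ then tgt a else v.

Fixpoint is_walk (v : vert Q) (w : seq (arr Q)) : bool :=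
  if w is a :: w' then (src a == walk_tgt v w') && is_walk v w' else true.

(* A path is its source together with its arrows; (v, [::]) is the trivial
   path at v. *)
Definition qpath := {p : vert Q * seq (arr Q) | is_walk p.1 p.2}.

Definition psrc (p : qpath) : vert Q := (val p).1.
Definition parr (p : qpath) : seq (arr Q) := (val p).2.
Definition ptgt (p : qpath) : vert Q := walk_tgt (psrc p) (parr p).

Lemma comp_walk (p q : qpath) :
  psrc p = ptgt q -> is_walk (psrc q) (parr p ++ parr q).
Proof.
case: p q => [[u w] /= Hw] [[v x] /= Hx]; rewrite /ptgt /psrc /parr /= => Huv.
elim: w Hw => [//|a w IHw] /= /andP[/eqP Ha Hw].
rewrite (IHw Hw) andbT Ha; apply/eqP.
by case: w {IHw Hw Ha} => [|b w].
Qed.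

Variable K : closedFieldType.

(* The underlying K-vector space of KQ, with basis the paths. *)
Definition path_alg := {malg K[qpath]}.

Definition mul_path (p q : qpath) : path_alg :=
  match @eqP _ (psrc p) (ptgt q) with
  | ReflectT e =>
      << (exist _ (psrc q, parr p ++ parr q) (comp_walk e) : qpath) >>
  | ReflectF _ => 0
  end.

Definition mul_alg (f g : path_alg) : path_alg :=
  \sum_(p <- msupp f) \sum_(q <- msupp g) (f@_p * g@_q) *: mul_path p q.

(* The two-sided ideal generated by rho. It is closed under scaling because KQ
   is unital. *)
Inductive in_ideal (rho : qpath -> Prop) : path_alg -> Prop :=
| ideal_gen p : rho p -> in_ideal rho << p >>
| ideal_0 : in_ideal rho 0
| ideal_add f g : in_ideal rho f -> in_ideal rho g -> in_ideal rho (f + g)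
| ideal_mull f g : in_ideal rho g -> in_ideal rho (mul_alg f g)
| ideal_mulr f g : in_ideal rho f -> in_ideal rho (mul_alg f g).

(* KQ / <rho> is spanned by finitely many residue classes. *)
Definition finite_dim_quotient (rho : qpath -> Prop) : Prop :=
  exists s : seq path_alg, forall f : path_alg, exists c : nat -> K,
    in_ideal rho (f - \sum_(i < size s) c i *: s`_i).

(* ab is a path which is not in <rho>. *)
Definition nonzero_pair (rho : qpath -> Prop) (a b : arr Q) : Prop :=
  exists2 p : qpath, parr p = [:: a; b] & ~ in_ideal rho << p >>.

End PathAlgebra.

Record string_algebra (K : closedFieldType) := StringAlgebra {
  sa_quiver :> quiver;
  sa_rel : qpath sa_quiver -> Prop;
  sa_rel_size : forall p, sa_rel p -> (2 <= size (parr p))%N;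
  sa_findim : finite_dim_quotient K sa_rel;
  sa_out : forall v : vert sa_quiver,
    (#|[set a : arr sa_quiver | src a == v]| <= 2)%N;
  sa_in : forall v : vert sa_quiver,
    (#|[set a : arr sa_quiver | tgt a == v]| <= 2)%N;
  sa_left : forall b a a' : arr sa_quiver,
    nonzero_pair K sa_rel a b -> nonzero_pair K sa_rel a' b -> a = a';
  sa_right : forall b c c' : arr sa_quiver,
    nonzero_pair K sa_rel b c -> nonzero_pair K sa_rel b c' -> c = c' }.

Section Strings.
Variables (K : closedFieldType) (A : string_algebra K).

(* (a, true) is the direct syllable a, (a, false) the inverse syllable a^-1. *)
Definition syl : Type := (arr A * bool)%type.
Definition is_direct (x : syl) : bool := x.2.
Definition is_inverse (x : syl) : bool := ~~ x.2.
Definition syl_inv (x : syl) : syl := (x.1, ~~ x.2).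
Definition ssrc (x : syl) : vert A := if x.2 then src x.1 else tgt x.1.
Definition stgt (x : syl) : vert A := if x.2 then tgt x.1 else src x.1.

Definition word_inv (w : seq syl) : seq syl := rev (map syl_inv w).
Definition direct_word (p : qpath A) : seq syl := [seq (a, true) | a <- parr p].

Definition string_word (w : seq syl) : Prop :=
  [/\ w <> [::],
      sorted (fun x y : syl => (ssrc x == stgt y) && (x != syl_inv y)) w
    & forall p, sa_rel p ->
        ~~ infix (direct_word p) w /\ ~~ infix (word_inv (direct_word p)) w].

(* Lazy v j is the string 1_(v,j) of length 0. *)
Inductive raw_string :=
| Lazy of vert A & bool
| Word of seq syl.

Definition is_string (x : raw_string) : Prop :=
  if x is Word w then string_word w else True.

Definition string_length (x : raw_string) : nat :=
  if x is Word w then size w else 0%N.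

Definition word_pow (n : nat) (w : seq syl) : seq syl := flatten (nseq n w).

Definition is_band (b : seq syl) : Prop :=
  (forall n, (1 <= n)%N -> string_word (word_pow n b)) /\
  ~ (exists c n, [/\ string_word c, (2 <= n)%N & b = word_pow n c]).

(* Finitely many bands up to cyclic permutation. *)
Definition domestic : Prop :=
  exists s : seq (seq syl), forall b, is_band b ->
    exists2 c, c \in s & exists k, b = rot k c.

Record sign_functions := SignFunctions {
  sgn : arr A -> bool;
  eps : arr A -> bool;
  sgn_src : forall a a' : arr A, a <> a' -> src a = src a' -> sgn a = ~~ sgn a';
  eps_tgt : forall b b' : arr A, b <> b' -> tgt b = tgt b' -> eps b = ~~ eps b';
  sgn_eps : forall (a b : arr A) (p : qpath A),
    parr p = [:: a; b] -> ~ sa_rel p -> sgn a = ~~ eps b }.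

Variable S : sign_functions.

Definition sgn_syl (x : syl) : bool := if x.2 then sgn S x.1 else eps S x.1.

(* is_cat z x y means y = z x, where z = [::] stands for a string of length 0.
   The string 1_(v,j) is a left substring of a string of positive length only
   if the first syllable of the latter starts at v and has sign -j. *)
Definition is_cat (z : seq syl) (x y : raw_string) : Prop :=
  match x, y with
  | Word u, Word w => w = z ++ u
  | Lazy v j, Word w =>
      w = z /\ exists u a, [/\ z = rcons u a, ssrc a = v & sgn_syl a = ~~ j]
  | Lazy v j, Lazy v' j' => [/\ z = [::], v = v' & j = j']
  | Word _, Lazy _ _ => False
  end.

(* y belongs to H_l(x0). *)
Definition hammock (x0 y : raw_string) : Prop :=
  is_string y /\ exists z, is_cat z x0 y.

Definition hammock_lt (x0 x y : raw_string) : Prop :=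
  x <> y /\
  [\/ exists z a, is_inverse a /\ is_cat (rcons z a) x y,
      exists z b, is_direct b /\ is_cat (rcons z b) y x
    | exists w z z' b a,
        [/\ hammock x0 w, is_direct b, is_inverse a,
            is_cat (rcons z b) w x & is_cat (rcons z' a) w y]].

Definition hammock_le (x0 x y : raw_string) : Prop :=
  x = y \/ hammock_lt x0 x y.

(* m is obtained from x0 by adding on the left only inverse syllables if i = 1,
   only direct syllables if i = -1. *)
Definition one_sided_ext (x0 : raw_string) (i : bool) (m : raw_string) : Prop :=
  is_string m /\
  exists2 z, is_cat z x0 m & all (if i then is_inverse else is_direct) z.

(* m is m_i(x0). *)
Definition extremal (x0 : raw_string) (i : bool) (m : raw_string) : Prop :=
  one_sided_ext x0 i m /\
  forall m', one_sided_ext x0 i m' -> (string_length m' <= string_length m)%N.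

(* y belongs to H_l^i(x0). *)
Definition hammock_side (x0 : raw_string) (i : bool) (y : raw_string) : Prop :=
  hammock x0 y /\
  exists2 m, extremal x0 i m &
    if i then hammock_le x0 x0 y /\ hammock_le x0 y m
    else hammock_le x0 m y /\ hammock_le x0 y x0.

Definition hammock_side_type (x0 : raw_string) (i : bool) : Type :=
  {y : raw_string | hammock_side x0 i y}.

Definition hammock_side_lt (x0 : raw_string) (i : bool)
    (x y : hammock_side_type x0 i) : Prop :=
  hammock_lt x0 (sval x) (sval y).

End Strings.

Section LinearOrders.

Definition sum_lt T T' (lt : T -> T -> Prop) (lt' : T' -> T' -> Prop)
    (x y : T + T') : Prop :=
  match x, y with
  | inl a, inl b => lt a b
  | inl _, inr _ => True
  | inr _, inl _ => False
  | inr a, inr b => lt' a b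
  end.

Definition omega_lt T (lt : T -> T -> Prop) (x y : nat * T) : Prop :=
  (x.1 < y.1)%N \/ (x.1 = y.1 /\ lt x.2 y.2).

Definition omega_star_lt T (lt : T -> T -> Prop) (x y : nat * T) : Prop :=
  (y.1 < x.1)%N \/ (x.1 = y.1 /\ lt x.2 y.2).

(* Linear orders are given by their strict order relations. *)
Inductive LOfp : forall T : Type, (T -> T -> Prop) -> Prop :=
| LOfp_one : LOfp (fun _ _ : unit => False)
| LOfp_sum T T' (lt : T -> T -> Prop) (lt' : T' -> T' -> Prop) :
    LOfp lt -> LOfp lt' -> LOfp (sum_lt lt lt')
| LOfp_omega T (lt : T -> T -> Prop) : LOfp lt -> LOfp (omega_lt lt)
| LOfp_omega_star T (lt : T -> T -> Prop) : LOfp lt -> LOfp (omega_star_lt lt)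
| LOfp_iso T T' (lt : T -> T -> Prop) (lt' : T' -> T' -> Prop) (f : T -> T') :
    bijective f -> (forall x y, lt x y <-> lt' (f x) (f y)) ->
    LOfp lt -> LOfp lt'.

Definition bounded T (lt : T -> T -> Prop) : Prop :=
  (exists m, forall x, m = x \/ lt m x) /\ (exists m, forall x, x = m \/ lt x m).

Definition covers T (lt : T -> T -> Prop) (x y : T) : Prop :=
  lt x y /\ ~ (exists z, lt x z /\ lt z y).

Definition discrete T (lt : T -> T -> Prop) : Prop :=
  (forall x, (exists y, lt x y) -> exists y, covers lt x y) /\
  (forall x, (exists y, lt y x) -> exists y, covers lt y x).

Definition dLOfpb T (lt : T -> T -> Prop) : Prop :=
  [/\ LOfp lt, bounded lt & discrete lt].

End LinearOrders.

(* Main.v *)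
Require Import Defs.
From mathcomp Require Import all_boot all_order all_algebra.
From mathcomp Require Import finmap boolp.
From mathcomp.multinomials Require Import monalg.

Set Implicit Arguments.
Unset Strict Implicit.
Unset Printing Implicit Defensive.

(** Read from the fixed end [x0], the strings of a hammock form a binary tree:
    a string has at most one extension by a direct syllable and at most one by
    an inverse syllable, because the sign functions leave a single candidate for
    each ([ext_tree_binary]). The hammock order is the in-order traversal of
    this tree ([hammock_lt_inorder]), and the interval [H_l^i(x0)] consists of
    the root together with the branch above it or below it ([hammock_sideP]).

    Finite presentability. Finite dimensionality bounds the length of nonzero
    paths, hence of one-sided runs of syllables in a string
    ([string_run_bound]). Therefore the ways to extend a string depend only on
    its last few syllables ([string_window]), and the tree has finitely many
    subtrees up to isomorphism. Call a word a return word of a node if it leads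
    from the node to another with the same residual tree. Two return words
    [a, b] of one node commute: all powers of [a^n b] are strings, so [a^n b] is
    a power of a band, and by domesticity the length of that band is bounded
    independently of [n]; for large [n] the band has to commute with [a]
    ([pow_comm], [domestic_commute]). Since return words commute, a branch that
    leaves the path of a return word never comes back to the same residual, and
    induction on the number of reachable residuals applies ([fp_residual]). At a
    node without return word the tree is lower branch + root + upper branch. At
    a node with return word [c], let [L] (resp. [R]) be the finite sum of the
    nodes on the path [c] and branches off it which lie below (resp. above) the
    node reached by [c]; then the tree [T] satisfies [T = L + T + R], and as
    each node lies at finite depth, [T = omega * L + omega^* * R]
    ([fp_self_similar]).

    Boundedness and discreteness. As runs are bounded, going up from the root
    as long as possible ends, and the node where it ends is the maximum
    ([inorder_max]). The successor of a node is the minimum of its upper branch,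
    or, if there is none, the deepest ancestor whose lower branch contains the
    node ([inorder_succ]). Minima and predecessors are obtained by exchanging
    up and down. *)

Local Notation wpow n w := (flatten (nseq n w)).

(** * Suborders that are finitely presented *)

Section Realization.
Variables (U : Type) (ltU : U -> U -> Prop).

(** A suborder is given by a parametrization, so that it needs no subtype and
    orders built by [LOfp] can be compared with it directly. *)
Definition realizes T (lt : T -> T -> Prop) (D : U -> Prop) : Prop :=
  exists f : T -> U,
    [/\ injective f, forall x y, lt x y <-> ltU (f x) (f y)
      & forall u, D u <-> exists x, f x = u].

Definition fp_subset (D : U -> Prop) : Prop :=
  exists T (lt : T -> T -> Prop), LOfp lt /\ realizes lt D.

Lemma realizes_iso T T' (lt : T -> T -> Prop) (lt' : T' -> T' -> Prop) D :
  realizes lt D -> realizes lt' D -> LOfp lt -> LOfp lt'.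
Proof.
move=> [f [finj flt fD]] [g [ginj glt gD]].
have hE x : exists y, g y = f x by apply/gD/fD; exists x.
have kE y : exists x, f x = g y by apply/fD/gD; exists y.
have [h hP] := choice hE; have [k kP] := choice kE.
apply: (@LOfp_iso _ _ _ _ h).
  by exists k => z; [apply: finj; rewrite kP hP | apply: ginj; rewrite hP kP].
by move=> x y; rewrite glt !hP flt.
Qed.

Lemma fp_ext (D D' : U -> Prop) :
  (forall u, D u <-> D' u) -> fp_subset D -> fp_subset D'.
Proof.
move=> DE [T [lt [fpT [f [finj flt fD]]]]]; exists T, lt; split=> //.
by exists f; split=> // u; rewrite -DE.
Qed.

Lemma realizes_bounded T (lt : T -> T -> Prop) D : realizes lt D ->
  (exists2 m, D m & forall u, D u -> m = u \/ ltU m u) ->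
  (exists2 m, D m & forall u, D u -> u = m \/ ltU u m) ->
  bounded lt.
Proof.
move=> [f [finj flt fD]] [m /fD[a <-] am] [n /fD[b <-] bm].
have fT x : D (f x) by apply/fD; exists x.
split; [exists a | exists b] => x.
  by have [/finj ->|/flt] := am _ (fT x); [left|right].
by have [/finj ->|/flt] := bm _ (fT x); [left|right].
Qed.

Lemma realizes_discrete T (lt : T -> T -> Prop) D : realizes lt D ->
  (forall u v, D u -> D v -> ltU u v -> exists2 w, D w &
     ltU u w /\ forall z, D z -> ltU u z -> ltU z w -> False) ->
  (forall u v, D u -> D v -> ltU v u -> exists2 w, D w &
     ltU w u /\ forall z, D z -> ltU w z -> ltU z u -> False) ->
  discrete lt.
Proof.
move=> [f [finj flt fD]] succ pred.
have fT x : D (f x) by apply/fD; exists x.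
split=> x [y] /flt xy.
  have [_ /fD[w <-] [uw nz]] := succ _ _ (fT _) (fT _) xy.
  exists w; split; first exact/flt.
  by move=> [z [/flt h1 /flt h2]]; apply: nz h1 h2.
have [_ /fD[w <-] [uw nz]] := pred _ _ (fT _) (fT _) xy.
exists w; split; first exact/flt.
by move=> [z [/flt h1 /flt h2]]; apply: nz h1 h2.
Qed.

Hypothesis ltU_irr : forall u, ~ ltU u u.
Hypothesis ltU_trans : forall u v w, ltU u v -> ltU v w -> ltU u w.

Lemma fp_single u0 : fp_subset (fun u => u = u0).
Proof.
exists unit, (fun _ _ => False); split; first exact: LOfp_one.
exists (fun=> u0); split=> [[] []|x y|u] //.
  by split=> // /ltU_irr.
by split=> [->|[]]; first exists tt.
Qed.

Lemma fp_union (D1 D2 : U -> Prop) :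
  (forall u v, D1 u -> D2 v -> ltU u v) ->
  fp_subset D1 -> fp_subset D2 -> fp_subset (fun u => D1 u \/ D2 u).
Proof.
move=> D12 [T1 [lt1 [fp1 [f1 [inj1 ltE1 D1E]]]]].
move=> [T2 [lt2 [fp2 [f2 [inj2 ltE2 D2E]]]]].
have f12 x y : ltU (f1 x) (f2 y).
  by apply: D12; [apply/D1E; exists x | apply/D2E; exists y].
exists (T1 + T2)%type, (sum_lt lt1 lt2); split; first exact: LOfp_sum.
exists (fun x => match x with inl a => f1 a | inr b => f2 b end); split.
- move=> [a|a] [b|b] //=.
  + by move=> /inj1 ->.
  + by move=> e; case: (@ltU_irr (f1 a)); rewrite {2}e.
  + by move=> e; case: (@ltU_irr (f1 b)); rewrite -{2}e.
  + by move=> /inj2 ->.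
- move=> [a|a] [b|b] //=; split=> // h.
  by case: (ltU_irr (ltU_trans (f12 b a) h)).
- move=> u; split.
    by move=> [/D1E[x <-]|/D2E[x <-]]; [exists (inl x)|exists (inr x)].
  by move=> [[x|x] <-]; [left; apply/D1E|right; apply/D2E]; exists x.
Qed.

Lemma fp_image (g : U -> U) (D : U -> Prop) :
  injective g -> (forall u v, ltU (g u) (g v) <-> ltU u v) ->
  fp_subset D -> fp_subset (fun u => exists2 v, D v & u = g v).
Proof.
move=> ginj glt [T [lt [fpT [f [finj flt fD]]]]].
exists T, lt; split=> //; exists (g \o f); split=> [|x y|u] /=.
- exact: inj_comp.
- by rewrite glt.
- split=> [[v /fD[x <-] ->]|[x <-]]; first by exists x.
  by exists (f x) => //; apply/fD; exists x.
Qed.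

Lemma fp_omega (g : nat -> U -> U) (D : U -> Prop) :
  (forall n, injective (g n)) ->
  (forall n u v, ltU (g n u) (g n v) <-> ltU u v) ->
  (forall n m u v, D u -> D v -> (n < m)%N -> ltU (g n u) (g m v)) ->
  fp_subset D -> fp_subset (fun u => exists n, exists2 v, D v & u = g n v).
Proof.
move=> ginj glt gD [T [lt [fpT [f [finj flt fD]]]]].
have fT x : D (f x) by apply/fD; exists x.
exists (nat * T)%type, (omega_lt lt); split; first exact: LOfp_omega.
exists (fun p => g p.1 (f p.2)); split=> [[n x] [m y]|[n x] [m y]|u] /=.
- case: (ltngtP n m) => [nm|mn|<-] e.
  + by case: (@ltU_irr (g n (f x))); rewrite {2}e; apply: gD.
  + by case: (@ltU_irr (g n (f x))); rewrite {1}e; apply: gD.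
  + by move/ginj/finj: e => ->.
- rewrite /omega_lt /=; split.
    by case=> [|[<- /flt]]; [apply: gD | rewrite glt].
  case: (ltngtP n m) => [nm|mn|<-] h; first by left.
    by case: (ltU_irr (ltU_trans h (gD _ _ _ _ _ _ mn))).
  by right; split=> //; move/glt/flt: h.
- split=> [[n [v /fD[x <-] ->]]|[[n x] /= <-]]; first by exists (n, x).
  by exists n, (f x).
Qed.

Lemma fp_omega_star (g : nat -> U -> U) (D : U -> Prop) :
  (forall n, injective (g n)) ->
  (forall n u v, ltU (g n u) (g n v) <-> ltU u v) ->
  (forall n m u v, D u -> D v -> (n < m)%N -> ltU (g m u) (g n v)) ->
  fp_subset D -> fp_subset (fun u => exists n, exists2 v, D v & u = g n v).
Proof.
move=> ginj glt gD [T [lt [fpT [f [finj flt fD]]]]].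
have fT x : D (f x) by apply/fD; exists x.
exists (nat * T)%type, (omega_star_lt lt); split; first exact: LOfp_omega_star.
exists (fun p => g p.1 (f p.2)); split=> [[n x] [m y]|[n x] [m y]|u] /=.
- case: (ltngtP n m) => [nm|mn|<-] e.
  + by case: (@ltU_irr (g n (f x))); rewrite {1}e; apply: gD.
  + by case: (@ltU_irr (g n (f x))); rewrite {2}e; apply: gD.
  + by move/ginj/finj: e => ->.
- rewrite /omega_star_lt /=; split.
    by case=> [|[<- /flt]]; [apply: gD | rewrite glt].
  case: (ltngtP n m) => [nm|mn|<-] h; last by right; split=> //; move/glt/flt: h.
    by case: (ltU_irr (ltU_trans h (gD _ _ _ _ _ _ nm))).
  by left.
- split=> [[n [v /fD[x <-] ->]]|[[n x] /= <-]]; first by exists (n, x).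
  by exists n, (f x).
Qed.

(** [LOfp] has no empty member, whereas a node of a tree may lack a lower or an
    upper branch. *)
Definition fp_or_empty (D : U -> Prop) : Prop := (forall u, ~ D u) \/ fp_subset D.

Lemma fpe_ext (D D' : U -> Prop) :
  (forall u, D u <-> D' u) -> fp_or_empty D -> fp_or_empty D'.
Proof.
move=> DE [nD|]; last by move/(fp_ext DE); right.
by left=> u /DE /nD.
Qed.

Lemma fpe_union (D1 D2 : U -> Prop) :
  (forall u v, D1 u -> D2 v -> ltU u v) ->
  fp_or_empty D1 -> fp_or_empty D2 -> fp_or_empty (fun u => D1 u \/ D2 u).
Proof.
move=> D12 [n1|fp1] [n2|fp2].
- by left=> u [/n1|/n2].
- by right; apply: fp_ext fp2 => u; split=> [|[/n1|]]; first right.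
- by right; apply: fp_ext fp1 => u; split=> [|[|/n2]]; first left.
- by right; apply: fp_union.
Qed.

Lemma fpe_image (g : U -> U) (D : U -> Prop) :
  injective g -> (forall u v, ltU (g u) (g v) <-> ltU u v) ->
  fp_or_empty D -> fp_or_empty (fun u => exists2 v, D v & u = g v).
Proof.
move=> ginj glt [nD|fpD]; first by left=> u [v /nD].
by right; apply: fp_image.
Qed.

Lemma fpe_fp (D : U -> Prop) u : D u -> fp_or_empty D -> fp_subset D.
Proof. by move=> Du [/(_ _ Du)|]. Qed.

End Realization.

(** * In-order traversal of a binary tree of words *)

Section Inorder.
Variables (X : eqType) (up : X -> bool).
Implicit Types (u v w c : seq X) (x y : X) (P : seq X -> Prop).

(** A word is a node of a tree, its letters being read from the root; [up] tells
    in which direction a letter leads. The branch in direction [up] comes after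
    a node, the other one before it. Siblings in the same direction are
    incomparable, but a [binary_tree] has none. *)
Fixpoint inorder u v : bool :=
  match u, v with
  | [::], [::] => false
  | [::], y :: _ => up y
  | x :: _, [::] => ~~ up x
  | x :: u', y :: v' => if x == y then inorder u' v' else ~~ up x && up y
  end.

Lemma inorder_irr u : ~ inorder u u.
Proof. by elim: u => //= x u IHu; rewrite eqxx. Qed.

Lemma inorder_trans u v w : inorder u v -> inorder v w -> inorder u w.
Proof.
elim: u v w => [|x u IHu] [|y v] [|z w] //=.
- by move=> ->.
- by have [<- //|_ yup /andP[]] := eqVneq y z; rewrite yup.
- move=> xd zu; have [xz|_] := eqVneq x z; last by rewrite xd zu.
  by rewrite xz zu in xd.
- by have [<- //|_ /andP[]] := eqVneq x y.
have [<-|xy] := eqVneq x y; first by case: eqP => // _; apply: IHu.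
case/andP=> xd yup; have [<-|_] := eqVneq y z; last by rewrite yup.
by rewrite (negPf xy) xd yup.
Qed.

Lemma inorder_cat2 c u v : inorder (c ++ u) (c ++ v) = inorder u v.
Proof. by elim: c => //= x c ->; rewrite eqxx. Qed.

(** The comparison is settled where [u] leaves the path [c]. *)
Lemma inorder_off c u w : ~~ prefix c u ->
  inorder u (c ++ w) = inorder u c /\ inorder (c ++ w) u = inorder c u.
Proof.
elim: c u => [|x c IHc] [|y u] //=; have [_|_ _] := eqVneq x y => //=.
exact: IHc.
Qed.

Lemma inorder_convex c u v z :
  inorder (c ++ u) z -> inorder z (c ++ v) -> exists z', z = c ++ z'.
Proof.
elim: c z => [|x c IHc] [|y z] /=; [by exists [::] | by exists (y :: z) | |].
  by move=> /negPf ->.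
have [<-|_] := eqVneq x y.
  by move=> h1 h2; have [z' ->] := IHc _ h1 h2; exists z'.
by case/andP=> _ yup /andP[]; rewrite yup.
Qed.

Lemma inorderP u v : reflect
  [\/ exists2 x, up x & exists r, v = u ++ x :: r,
      exists2 x, ~~ up x & exists r, u = v ++ x :: r
    | exists c x y r s, [/\ ~~ up x, up y, u = c ++ x :: r & v = c ++ y :: s]]
  (inorder u v).
Proof.
apply: (iffP idP); last first.
  case=> [[x ux [r ->]]|[x ux [r ->]]|[c [x [y [r [s [ux uy -> ->]]]]]]].
  - by rewrite -{1}[u]cats0 inorder_cat2.
  - by rewrite -{2}[v]cats0 inorder_cat2.
  - rewrite inorder_cat2 /= ux uy; case: eqP => // xy.
    by rewrite xy uy in ux.
elim: u v => [|x u IHu] [|y v] //=.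
- by move=> uy; apply: Or31; exists y => //; exists v.
- by move=> ux; apply: Or32; exists x => //; exists u.
case: eqP => [<-|_] => [/IHu|/andP[ux uy]]; last first.
  by apply: Or33; exists [::], x, y, u, v.
case=> [[z uz [r ->]]|[z uz [r ->]]|[c [z [y' [r [s [uz uy -> ->]]]]]]].
- by apply: Or31; exists z => //; exists r.
- by apply: Or32; exists z => //; exists r.
- by apply: Or33; exists (x :: c), z, y', r, s.
Qed.

Definition residual P w : seq X -> Prop := fun u => P (w ++ u).

(** The binary trees whose in-order traversal is [inorder]. *)
Definition binary_tree P : Prop :=
  (forall u v, P (u ++ v) -> P u) /\
  (forall u x y, P (rcons u x) -> P (rcons u y) -> up x = up y -> x = y).

Lemma residual_tree P w : binary_tree P -> binary_tree (residual P w).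
Proof.
move=> [Pp Pd]; split=> [u v|u x y]; rewrite /residual.
  by rewrite catA; apply: Pp.
by rewrite -!rcons_cat; apply: Pd.
Qed.

Lemma residual_cat P w w' u : residual (residual P w) w' u = residual P (w ++ w') u.
Proof. by rewrite /residual catA. Qed.

Lemma tree_child P x y u v : binary_tree P -> P (x :: u) -> P (y :: v) ->
  up x = up y -> x = y.
Proof.
move=> [Pp Pd] Px Py; apply: (Pd [::]); [apply: (Pp _ u)|exact: (Pp _ v)].
exact: Px.
Qed.

Lemma tree_total P u v : binary_tree P -> P u -> P v ->
  [\/ u = v, inorder u v | inorder v u].
Proof.
elim: u v P => [|x u IHu] [|y v] P tP Pu Pv /=; first by apply: Or31.
- by case: (up y); [apply: Or32|apply: Or33].
- by case: (up x); [apply: Or33|apply: Or32].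
rewrite [y == x]eq_sym; case: eqP => [xy|nxy].
  subst y.
  by have [->|h|h] := IHu v (residual P [:: x]) (residual_tree _ tP) Pu Pv;
    [apply: Or31|apply: Or32|apply: Or33].
have : up x <> up y by move/(tree_child tP Pu Pv)/nxy.
by case: (up x); case: (up y) => // _; [apply: Or33|apply: Or32].
Qed.

Local Notation fp := (fp_subset inorder).
Local Notation fpe := (fp_or_empty inorder).

Definition branch P b u : Prop :=
  exists2 u', P u & exists2 y, up y = b & u = y :: u'.

Lemma cat_inj (c : seq X) : injective (cat c).
Proof. by move=> u v /eqP; rewrite eqseq_cat // eqxx => /eqP. Qed.

Lemma inorder_catE (c : seq X) u v :
  inorder (c ++ u) (c ++ v) <-> inorder u v.
Proof. by rewrite inorder_cat2. Qed.

Lemma fpe_branch P b : binary_tree P ->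
  (forall y, up y = b -> P [:: y] -> fp (residual P [:: y])) -> fpe (branch P b).
Proof.
move=> tP fpc; have [Pp _] := tP.
have [[y [yb Py]]|nP] := EM (exists y, up y = b /\ P [:: y]); last first.
  left=> u [u' Pu [y yb uE]]; apply: nP; exists y; split=> //.
  by apply: (Pp _ u'); rewrite /= -uE.
right; have := fp_image (@cat_inj [:: y]) (inorder_catE [:: y]) (fpc y yb Py).
apply: fp_ext => u; split=> [[v Pv ->]|[u' Pu [z zb uE]]].
  by exists v => //; exists y.
have Pz : P (z :: u') by rewrite -uE.
by exists u'; rewrite (tree_child tP Py Pz) ?zb // uE.
Qed.

Lemma fpe_empty_word : fpe (fun u => u = [::]).
Proof. right; exact/fp_single/inorder_irr. Qed.

Definition side_of P c b u : Prop :=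
  [/\ P u, ~~ prefix c u & if b then inorder c u else inorder u c].

Lemma fpe_union_inorder (D1 D2 : seq X -> Prop) :
  (forall u v, D1 u -> D2 v -> inorder u v) ->
  fpe D1 -> fpe D2 -> fpe (fun u => D1 u \/ D2 u).
Proof. apply: fpe_union; [exact: inorder_irr | exact: inorder_trans]. Qed.

(** If the first letter of the path leads away from side [b], the root and its
    other branch fall on side [b]; otherwise the first step contributes nothing
    to that side. *)
Lemma side_of_cons P x c b : binary_tree P -> P (x :: c) ->
  forall u, side_of P (x :: c) b u <->
    (exists2 v, side_of (residual P [:: x]) c b v & u = x :: v) \/
    (up x = ~~ b /\ (u = [::] \/ branch P b u)).
Proof.
move=> tP Pc [|y u]; split.
- by case=> _ _ /=; case: b; case: (up x) => //=; right; split=> //; left.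
- case=> [[v _ //]|[xb _]]; split=> //; last by case: (b) xb => /=; case: (up x).
  by case: tP => Pp _; apply: (Pp _ (x :: c)).
- case=> Pu /=; rewrite [y == x]eq_sym; case: eqP => [xy /= nu xb|xy _ xb].
    by subst y; left; exists u.
  right; have : up x <> up y by move/(tree_child tP Pc Pu)/xy.
  move=> xy'; have yb : up y = b by case: (b) xb => /andP[]; case: (up y).
  split; first by case: (b) yb xy' => ->; case: (up x).
  by right; exists u => //; exists y.
- case=> [[v [Pv nv vb] [-> ->]]|[xb [//|[u' Pu [z zb [zE _]]]]]].
    by split; rewrite //= eqxx.
  subst z; have xy : (x == y) = false.
    by apply/eqP => xy; move: xb; rewrite xy zb; case: (b).
  split; rewrite //= ?[y == x]eq_sym xy // xb zb; by case: (b).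
Qed.

(** Along a path, each step adds to one of the two sides a node and the branch
    that the path does not follow, so both sides are finite sums. *)
Lemma fpe_side P c b : binary_tree P -> P c ->
  (forall c1 x c2 y, c = c1 ++ x :: c2 -> y != x -> P (rcons c1 y) ->
     fp (residual P (rcons c1 y))) ->
  fpe (side_of P c b).
Proof.
elim: c P => [|x c IHc] P tP Pc fpc; first by left=> u [_]; rewrite prefix0s.
have fpx : fpe (fun u => exists2 v, side_of (residual P [:: x]) c b v & u = x :: v).
  apply: (fpe_image (@cat_inj [:: x]) (inorder_catE [:: x])).
  apply: IHc => [||c1 z c2 y cE yz Py]; [exact: residual_tree|exact: Pc|].
  have := fpc (x :: c1) z c2 y; rewrite cE => /(_ erefl yz Py).
  by apply: fp_ext.
have [xb|xb] := eqVneq (up x) (~~ b); last first.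
  apply: fpe_ext fpx => u; rewrite side_of_cons //.
  by split=> [|[//|[xb' _]]]; [left|rewrite xb' eqxx in xb].
have fpb : fpe (fun u => u = [::] \/ branch P b u).
  have fpb : fpe (branch P b).
    apply: fpe_branch => // y yb Py; apply: (fpc [::] x c y) => //.
    by apply/eqP=> yx; move: xb; rewrite -yx yb; case: (b).
  case: b {xb fpx IHc} fpb => fpb.
    apply: fpe_union_inorder fpb; last exact: fpe_empty_word.
    by move=> u v -> [v' _ [y yb ->]].
  apply: fpe_ext (fpe_union_inorder _ fpb fpe_empty_word) => [u|u v].
    by split=> [[]|[]]; tauto.
  by move=> [u' _ [y yb ->]] -> /=; rewrite yb.
have side_lt u v : (exists2 v', side_of (residual P [:: x]) c b v' & v = x :: v') ->
    u = [::] \/ branch P b u -> if b then inorder v u else inorder u v.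
  move=> [v' _ ->] [->|[u' Pu [y yb ->]]] /=; first by rewrite xb; case: (b).
  have -> : (x == y) = false by apply/eqP => xy; move: xb; rewrite xy yb; case: (b).
  have -> : (y == x) = false by apply/eqP => xy; move: xb; rewrite -xy yb; case: (b).
  by rewrite xb yb; case: (b).
have sideE u : side_of P (x :: c) b u <->
    (exists2 v, side_of (residual P [:: x]) c b v & u = x :: v) \/
    (u = [::] \/ branch P b u).
  by rewrite side_of_cons //; split=> [[|[_]]|[]]; tauto.
case: b xb fpx fpb side_lt sideE {IHc} => xb fpx fpb side_lt sideE.
  apply: fpe_ext (fpe_union_inorder _ fpx fpb) => [u|u v]; first by rewrite sideE.
  by move=> hu hv; apply: (side_lt v u).
apply: fpe_ext (fpe_union_inorder _ fpb fpx) => [u|u v].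
  by rewrite sideE; tauto.
by move=> hu hv; apply: (side_lt u v).
Qed.

Lemma pow_remainder c u : c != [::] ->
  exists n v, u = wpow n c ++ v /\ ~~ prefix c v.
Proof.
move=> c0; elim: {u}_.+1 {-2}u (ltnSn (size u)) => // k IHk u uk.
have [/prefixP[v uE]|nc] := boolP (prefix c u); last by exists 0, u.
have vk : size v < k.
  rewrite uE size_cat -addnS in uk.
  apply: leq_trans (_ : size c + size v <= _); last by rewrite -ltnS -addnS.
  by rewrite -[(size v).+1]add1n leq_add2r lt0n size_eq0.
have [n [w [vE ncw]]] := IHk _ vk.
by exists n.+1, w; rewrite uE vE /= catA.
Qed.

(** If the tree reappears at the end of [c], it is [L + T + R] with [L] and [R]
    the two sides of [c]. Each node [c^n v] has a finite number [n] of factors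
    [c], so nothing is left between the [omega] copies of [L] and the [omega^*]
    copies of [R] after unrolling. *)
Lemma fp_self_similar P c : binary_tree P -> c != [::] -> P c ->
  (forall u, P (c ++ u) <-> P u) ->
  (forall c1 x c2 y, c = c1 ++ x :: c2 -> y != x -> P (rcons c1 y) ->
     fp (residual P (rcons c1 y))) ->
  fp P.
Proof.
move=> tP c0 Pc self fpc.
have powP n u : P (wpow n c ++ u) <-> P u.
  by elim: n => //= n IHn; rewrite -catA self.
pose unroll b u := exists n, exists2 v, side_of P c b v & u = wpow n c ++ v.
have sideP b v : side_of P c b v -> P v by case.
have lt_pow n m (nm : n < m) u : exists w,
    wpow m c ++ u = wpow n c ++ c ++ w.
  exists (wpow (m - n.+1) c ++ u).
  by rewrite -{1}(subnKC nm) addSnnS nseqD flatten_cat /= -!catA.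
have fpb b : fpe (unroll b).
  have [nS|fpS] := fpe_side b tP Pc fpc; first by left=> u [n [v /nS]].
  right; case: b fpS => fpS.
    apply: (fp_omega_star (@inorder_irr) (@inorder_trans)) fpS
      => [n|n u v|n m u v Su [Pv nv cv] nm].
    + exact: cat_inj.
    + exact: inorder_catE.
    have [w ->] := lt_pow _ _ nm u; rewrite inorder_cat2.
    by have [_ ->] := inorder_off w nv.
  apply: (fp_omega (@inorder_irr) (@inorder_trans)) fpS
    => [n|n u v|n m u v [Pu nu uc] Sv nm].
  + exact: cat_inj.
  + exact: inorder_catE.
  have [w ->] := lt_pow _ _ nm v; rewrite inorder_cat2.
  by have [-> _] := inorder_off w nu.
have lt_unroll u v : unroll false u -> unroll true v -> inorder u v.
  move=> [n [u' [Pu nu uc] ->]] [m [v' [Pv nv cv] ->]].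
  have [nm|mn|->] := ltngtP n m.
  - have [w ->] := lt_pow _ _ nm v'; rewrite inorder_cat2.
    by have [-> _] := inorder_off w nu.
  - have [w ->] := lt_pow _ _ mn u'; rewrite inorder_cat2.
    by have [_ ->] := inorder_off w nv.
  - by rewrite inorder_cat2; apply: inorder_trans uc cv.
have P0 : P [::] by case: tP => Pp _; apply: (Pp _ c).
apply: (fpe_fp P0); apply: fpe_ext (fpe_union_inorder lt_unroll (fpb false) (fpb true)).
move=> u; split=> [[] [n [v /sideP Pv ->]]|Pu]; [exact/powP|exact/powP|].
have [n [v [uE nv]]] := pow_remainder u c0.
have Pv : P v by move: Pu; rewrite uE powP.
have [vc|vc|cv] := tree_total tP Pv Pc.
- by rewrite vc prefix_refl in nv.
- by left; exists n, v.
- by right; exists n, v.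
Qed.

Lemma fp_tree_step P : binary_tree P -> P [::] ->
  (forall y, P [:: y] -> fp (residual P [:: y])) -> fp P.
Proof.
move=> tP P0 fpc; apply: (fpe_fp P0).
have fpb b : fpe (branch P b) by apply: fpe_branch => // y _; apply: fpc.
have lt0 u v : branch P false u -> v = [::] -> inorder u v.
  by move=> [u' _ [y yb ->]] -> /=; rewrite yb.
have lt1 u v : branch P false u \/ u = [::] -> branch P true v -> inorder u v.
  move=> h [v' _ [y yb ->]]; case: h => [[u' _ [x xb ->]]|->] //=.
  by rewrite xb yb; case: eqP => // xy; rewrite xy yb in xb.
have fp_lower := fpe_union_inorder lt0 (fpb false) fpe_empty_word.
apply: fpe_ext (fpe_union_inorder lt1 fp_lower (fpb true)) => u.
split=> [[[[]|->]|[]] //|]; case: u => [|x u] Pu; first by left; right.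
by case xb: (up x); [right|left; left]; exists u => //; exists x.
Qed.

(** Induction on the number of residual trees reachable from [w]. A branch leaving
    the path of a return word [c] at a letter [y] cannot reach the residual of
    [w] again: the resulting return word [c'] would have to commute with [c],
    while [c] and [c'] differ at the letter [y]. *)
Lemma fp_residual P (F : finType) (key : seq X -> F) :
  binary_tree P ->
  (forall w w', P w -> P w' -> key w = key w' ->
     forall u, P (w ++ u) <-> P (w' ++ u)) ->
  (forall w c c', P w -> c != [::] -> c' != [::] -> P (w ++ c) -> P (w ++ c') ->
     (forall u, P (w ++ c ++ u) <-> P (w ++ u)) ->
     (forall u, P (w ++ c' ++ u) <-> P (w ++ u)) -> c ++ c' = c' ++ c) ->
  forall w, P w -> fp (residual P w).
Proof.
move=> tP keyP comm; have [Pp Pd] := tP.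
pose reach w := [set f | `[< exists2 u, P (w ++ u) & key (w ++ u) = f >]].
have reach_ext w v : reach (w ++ v) \subset reach w.
  apply/fintype.subsetP => f; rewrite !inE => /asboolP[u Pu <-]; apply/asboolP.
  by exists (v ++ u); rewrite catA.
move=> w; elim: {w}_.+1 {-2}w (ltnSn #|reach w|) => // k IHk w wk Pw.
have reach_lt v : P (w ++ v) ->
    (forall u, P (w ++ v ++ u) -> key (w ++ v ++ u) = key w -> False) ->
    fp (residual P (w ++ v)).
  move=> Pv nret; apply: IHk => //; apply: leq_trans (wk : #|reach w| <= k).
  (* The residual of [w] itself is no longer reachable. *)
  apply: proper_card; rewrite properE reach_ext /=.
  apply/subsetPn; exists (key w); rewrite inE.
    by apply/asboolP; exists [::]; rewrite cats0.
  by apply/asboolP=> -[u]; rewrite -catA; apply: nret.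
have ret v : P (w ++ v) -> key (w ++ v) = key w ->
    forall u, P (w ++ v ++ u) <-> P (w ++ u).
  by move=> Pv kv u; rewrite catA; apply: keyP.
have [[c [c0 Pc kc]]|nret] :=
    EM (exists c, [/\ c != [::], P (w ++ c) & key (w ++ c) = key w]); last first.
  apply: fp_tree_step => [||y Py]; first exact: residual_tree.
    by rewrite /residual cats0.
  apply: fp_ext (reach_lt [:: y] Py _) => [u|u Pu ku]; first by rewrite residual_cat.
  by apply: nret; exists (y :: u).
apply: (@fp_self_similar _ c) => [||//||c1 x c2 y cE yx Py] //.
- exact: residual_tree.
- exact: ret.
apply: fp_ext (reach_lt (rcons c1 y) Py _) => [u|u Pu ku]; first by rewrite residual_cat.
have c'0 : rcons c1 y ++ u != [::] by case: (c1).
have := comm w c (rcons c1 y ++ u) Pw c0 c'0 Pc Pu (ret _ Pc kc) (ret _ Pu ku).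
rewrite {1}cE cat_rcons -!catA => /cat_inj [xy].
by rewrite xy eqxx in yx.
Qed.

End Inorder.

(** * Bounds, successors and predecessors *)

Section Discreteness.
Variable X : eqType.
Implicit Types (up : X -> bool) (u v w : seq X) (x y : X) (P : seq X -> Prop).

Lemma inorder_dual up u v : inorder (fun x => ~~ up x) u v = inorder up v u.
Proof.
elim: u v => [|x u IHu] [|y v] //=; first by rewrite negbK.
by have [_|_] := eqVneq x y; rewrite ?IHu // negbK andbC.
Qed.

Lemma binary_tree_dual up P : binary_tree up P -> binary_tree (fun x => ~~ up x) P.
Proof. by move=> [Pp Pd]; split=> // u x y Px Py /negb_inj; apply: Pd Px Py. Qed.

Lemma inorder_asym up u v : inorder up u v -> inorder up v u -> False.
Proof. by move=> uv /(inorder_trans uv) /inorder_irr. Qed.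

(** Any other node leaves the path [m] downwards, stops on it or goes down from
    its end. *)
Lemma inorder_max up P m : binary_tree up P -> P m -> all up m ->
  (forall x, up x -> ~ P (rcons m x)) ->
  forall v, P v -> v = m \/ inorder up v m.
Proof.
elim: m P => [|x m IHm] P tP Pm /= => [_|/andP[ux um]] mmax [|y v] Pv /=.
- by left.
- right; apply/negP => uy; case: (mmax _ uy).
  by case: tP => Pp _; apply: (Pp _ v); apply: Pv.
- by right.
have [yx|nyx] := eqVneq y x.
  subst y.
  by have [->|] := IHm _ (residual_tree [:: x] tP) Pm um mmax _ Pv; [left | right].
right; rewrite ux andbT; apply/negP => uy.
by move/eqP: nyx; apply; apply: tree_child tP Pv Pm _; rewrite uy ux.
Qed.

Definition bounded_runs up P : Prop :=
  exists N, forall w r, P (w ++ r) -> all up r -> size r <= N.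

Lemma maximal_run up P w : bounded_runs up P -> P w -> exists r,
  [/\ all up r, P (w ++ r) & forall x, up x -> ~ P (w ++ rcons r x)].
Proof.
move=> [N bN] Pw.
suff run k r : N - size r <= k -> all up r -> P (w ++ r) -> exists r,
    [/\ all up r, P (w ++ r) & forall x, up x -> ~ P (w ++ rcons r x)].
  by apply: (run N [::]); rewrite ?leq_subr ?cats0.
elim: k r => [|k IHk] r rk ur Pr.
all: have [[x [ux Px]]|nx] := EM (exists x, up x /\ P (w ++ rcons r x));
  last by exists r; split=> // x ux Px; apply: nx; exists x.
all: have ux' : all up (rcons r x) by rewrite all_rcons ux.
all: have := bN _ _ Px ux'; rewrite size_rcons => rN.
  by rewrite leqn0 subn_eq0 leqNgt rN in rk.
by apply: IHk ux' Px; rewrite size_rcons subnS -ltnS prednK // subn_gt0.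
Qed.

Lemma last_down up u : ~~ all up u ->
  exists c x r, [/\ ~~ up x, all up r & u = c ++ x :: r].
Proof.
elim/last_ind: u => // u y IHu; rewrite all_rcons.
case uy: (up y); last by exists u, y, [::]; rewrite uy cats1.
move=> /= /IHu[c [x [r [ux ur ->]]]].
by exists c, x, (rcons r y); rewrite all_rcons uy rcons_cat.
Qed.

(** The successor of [u] is the minimum of the upper branch of [u] if there is
    one; otherwise it is the deepest ancestor having [u] in its lower branch,
    because [u] is then the maximum of that branch. *)
Lemma inorder_succ up P u v : binary_tree up P ->
  bounded_runs (fun x => ~~ up x) P -> P u -> P v -> inorder up u v ->
  exists2 w, P w & inorder up u w /\
    forall z, P z -> inorder up u z -> inorder up z w -> False.
Proof.
move=> tP runs Pu Pv uv; have [Pp Pd] := tP.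
have [[x [ux Px]]|nx] := EM (exists x, up x /\ P (rcons u x)).
  have [r [dr Pr rmax]] := maximal_run runs Px.
  exists (u ++ x :: r); first by rewrite -cat_rcons.
  split; first by apply/inorderP; apply: Or31; exists x => //; exists r.
  move=> z Pz uz zw; have [[|y z'] zE] := inorder_convex (c := u) (u := [::])
      (z := z) (v := x :: r) (eq_ind_r (fun t => inorder up t z) uz (cats0 u)) zw.
    by move: uz; rewrite zE cats0 => /inorder_irr.
  subst z; move: uz; rewrite -{1}[u]cats0 inorder_cat2 /= => uy.
  have yx : y = x.
    by apply: (Pd u); rewrite ?uy ?ux // ; apply: (Pp _ z'); rewrite cat_rcons.
  subst y; rewrite inorder_cat2 /= eqxx in zw.
  rewrite -cat_rcons in Pz.
  have := inorder_max (binary_tree_dual (residual_tree (rcons u x) tP)) Pr dr rmax Pz.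
  rewrite inorder_dual => -[zr|/(inorder_asym zw)//].
  by rewrite zr in zw; apply: inorder_irr zw.
(* A node reached by upward steps only and without upper branch is the maximum. *)
have ndown : ~~ all up u.
  apply/negP => au.
  have umax x : up x -> ~ P (rcons u x) by move=> ux Px; apply: nx; exists x.
  have [vu|] := inorder_max tP Pu au umax Pv; last exact: inorder_asym uv.
  by rewrite vu in uv; apply: inorder_irr uv.
have [c [x [r [dx ur uE]]]] := last_down ndown; subst u.
exists c; first exact: Pp Pu.
split; first by apply/inorderP; apply: Or32; exists x => //; exists r.
move=> z Pz uz zc; have [[|y z'] zE] := inorder_convex (c := c) (u := x :: r)
    (z := z) (v := [::]) uz (eq_ind_r (fun t => inorder up z t) zc (cats0 c)).
  by move: zc; rewrite zE cats0 => /inorder_irr.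
subst z; move: zc; rewrite -{2}[c]cats0 inorder_cat2 /= => dy.
have yx : y = x.
  apply: (Pd c); [apply: (Pp _ z')|apply: (Pp _ r)|]; rewrite ?cat_rcons //.
  by rewrite (negPf dx) (negPf dy).
subst y; rewrite inorder_cat2 /= eqxx in uz.
rewrite -cat_rcons in Pz; rewrite -cat_rcons in Pu.
have rmax x' : up x' -> ~ residual P (rcons c x) (rcons r x').
  move=> ux' Px'; apply: nx; exists x'; split=> //.
  by rewrite -cat_rcons rcons_cat.
have := inorder_max (residual_tree (rcons c x) tP) Pu ur rmax Pz.
by move=> [zr|/(inorder_asym uz)//]; rewrite zr in uz; apply: inorder_irr uz.
Qed.

(** The tree counterpart of [H_l^i]. *)
Definition half_tree up P i u : Prop :=
  P u /\ (if u is x :: _ then up x == i else true).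

Lemma half_tree_dual up P i u :
  half_tree (fun x => ~~ up x) P (~~ i) u <-> half_tree up P i u.
Proof.
by case: u => //= x u; split=> -[Pu xi]; split=> //; move: xi; case: (i); case: (up x).
Qed.

Lemma half_tree_convex up P i u v w : half_tree up P i u -> half_tree up P i v ->
  P w -> inorder up u w -> inorder up w v -> half_tree up P i w.
Proof.
move=> [_ ui] [_ vi] Pw uw wv; split=> //; case: w {Pw} uw wv => // x w.
move=> uw wv; apply/negPn/negP => xi.
have neq y : up y == i -> (y == x) = false.
  by move=> yi; apply/eqP => yx; rewrite -yx yi in xi.
case: i ui vi neq xi => ui vi neq; case ux: (up x) => // _.
  case: u ui uw => [|y u] yi /=; first by rewrite ux.
  by rewrite neq // ux andbF.
case: v vi wv => [|y v] yi /=; first by rewrite ux.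
by rewrite eq_sym neq // ux.
Qed.

Lemma half_tree_succ up P i u v : binary_tree up P ->
  bounded_runs (fun x => ~~ up x) P ->
  half_tree up P i u -> half_tree up P i v -> inorder up u v ->
  exists2 w, half_tree up P i w & inorder up u w /\
    forall z, half_tree up P i z -> inorder up u z -> inorder up z w -> False.
Proof.
move=> tP runs Hu Hv uv; have [Pu _] := Hu; have [Pv _] := Hv.
have [w Pw [uw nz]] := inorder_succ tP runs Pu Pv uv.
exists w; last by split=> // z [Pz _]; apply: nz.
have [->//|wv|vw] := tree_total tP Pw Pv; first exact: half_tree_convex uw wv.
by case: (nz v).
Qed.

Lemma half_tree_max up P i : binary_tree up P -> P [::] -> bounded_runs up P ->
  exists2 m, half_tree up P i m & forall u, half_tree up P i u -> u = m \/ inorder up u m.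
Proof.
move=> tP P0 runs; case: i; last first.
  by exists [::] => // -[|x u] [_ xi]; [left | right; move: xi => /=; case: (up x)].
have [m [um Pm mmax]] := maximal_run runs P0.
exists m; first by split=> //; case: (m) um => //= x r /andP[->].
by move=> u [Pu _]; apply: inorder_max tP Pm um mmax _ Pu.
Qed.

Lemma dLOfpb_half_tree up P i (F : finType) (key : seq X -> F)
    T (lt : T -> T -> Prop) :
  binary_tree up P -> P [::] ->
  bounded_runs up P -> bounded_runs (fun x => ~~ up x) P ->
  (forall w w', P w -> P w' -> key w = key w' ->
     forall u, P (w ++ u) <-> P (w' ++ u)) ->
  (forall w c c', P w -> c != [::] -> c' != [::] -> P (w ++ c) -> P (w ++ c') ->
     (forall u, P (w ++ c ++ u) <-> P (w ++ u)) ->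
     (forall u, P (w ++ c' ++ u) <-> P (w ++ u)) -> c ++ c' = c' ++ c) ->
  realizes (inorder up) lt (half_tree up P i) -> dLOfpb lt.
Proof.
move=> tP P0 runs_up runs_down keyP comm rT.
have runs_up' : bounded_runs (fun x => ~~ ~~ up x) P.
  case: runs_up => N bN; exists N => w r Pr ar; apply: bN Pr _.
  by apply: sub_all ar => x; rewrite /= negbK.
have tP' := binary_tree_dual tP.
split.
- have : fp_subset (inorder up) (half_tree up P i).
    have fpb : fp_or_empty (inorder up) (branch up P i).
      by apply: fpe_branch => // y yi Py; apply: fp_residual tP keyP comm _ Py.
    have root_lt u v : u = [::] -> branch up P i v ->
        if i then inorder up u v else inorder up v u.
      by move=> -> [v' _ [y yi ->]] /=; rewrite yi; case: (i).
    have halfE u : (u = [::] \/ branch up P i u) <-> half_tree up P i u.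
      split=> [[->|[u' Pu [y yi uE]]]|[Pu]]; first by [].
        by split=> //; rewrite uE yi.
      case: u Pu => [|x u] Pu /= xi; [by left | right; exists u => //].
      by exists x => //; apply/eqP.
    apply: (@fpe_fp _ _ _ [::]) => //.
    case: i fpb root_lt halfE {rT} => fpb root_lt halfE.
      apply: fpe_ext (fpe_union_inorder _ (fpe_empty_word up) fpb) => [u|u v].
        exact: halfE.
      exact: root_lt.
    apply: fpe_ext (fpe_union_inorder _ fpb (fpe_empty_word up)) => [u|u v hu hv].
      by rewrite -halfE; tauto.
    exact: root_lt hv hu.
  by move=> [T' [lt' [fp' r']]]; apply: realizes_iso r' rT fp'.
- apply: realizes_bounded rT _ _; last exact: half_tree_max.
  have [m hm mmax] := half_tree_max (~~ i) tP' P0 runs_down.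
  exists m; first exact/half_tree_dual.
  by move=> u /half_tree_dual/mmax; rewrite inorder_dual => -[->|]; [left|right].
- apply: realizes_discrete rT _ _ => [u v|u v /half_tree_dual hu /half_tree_dual hv vu].
    exact: half_tree_succ.
  rewrite -inorder_dual in vu.
  have [w /half_tree_dual hw [uw nz]] := half_tree_succ tP' runs_up' hu hv vu.
  exists w => //; rewrite inorder_dual in uw; split=> // z /half_tree_dual hz wz zu.
  by apply: (nz z); rewrite ?inorder_dual.
Qed.

End Discreteness.

(** * Nonzero paths of a finite-dimensional quotient *)

Section PathBound.
Variables (Q : quiver) (K : closedFieldType) (rho : qpath Q -> Prop).
Import GRing.Theory.
Local Open Scope ring_scope.

(** For monomial relations these are the paths that vanish in the quotient. *)
Definition zero_path (p : qpath Q) : Prop :=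
  exists2 r, rho r & infix (parr r) (parr p).

(** The combinations of zero paths form a two-sided ideal containing [rho]. *)
Lemma in_ideal_coef (f : path_alg Q K) : in_ideal rho f ->
  forall p, ~ zero_path p -> f@_p = 0.
Proof.
elim=> {f} [r rr||f g _ IHf _ IHg|f g _ IH|f g _ IH] p np.
- rewrite mcoeffU; case: eqP => // rp; case: np; exists r => //.
  by rewrite rp infix_refl.
- exact: mcoeff0.
- by rewrite mcoeffD IHf // IHg // addr0.
- rewrite /mul_alg raddf_sum big1 // => a _; rewrite raddf_sum big1 // => b _.
  rewrite /= mcoeffZ /mul_path; case: eqP => [e|_]; last by rewrite mcoeff0 mulr0.
  rewrite mcoeffU; case: eqP => [pE|_]; last by rewrite mulr0n mulr0.
  rewrite IH ?mulr0 ?mul0r // => -[r rr rb]; apply: np; exists r => //.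
  by rewrite -pE /parr /=; apply: infix_catl.
- rewrite /mul_alg raddf_sum big1 // => a _; rewrite raddf_sum big1 // => b _.
  rewrite /= mcoeffZ /mul_path; case: eqP => [e|_]; last by rewrite mcoeff0 mulr0.
  rewrite mcoeffU; case: eqP => [pE|_]; last by rewrite mulr0n mulr0.
  rewrite IH ?mulr0 ?mul0r // => -[r rr rb]; apply: np; exists r => //.
  by rewrite -pE /parr /=; apply: infix_catr.
Qed.

(** Modulo the ideal, a nonzero path [p] is a combination of the spanning family;
    comparing the coefficients of [p], some member of the family has [p] in its
    support. Thus all nonzero paths lie in a finite union of finite supports. *)
Lemma nonzero_path_bound : finite_dim_quotient K rho ->
  exists N, forall p, ~ zero_path p -> (size (parr p) <= N)%N.
Proof.
move=> [s sP].
exists (\max_(f <- s) \max_(p <- msupp (f : path_alg Q K)) size (parr p))%N => p np.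
have [c cP] := sP << p >>.
have := in_ideal_coef cP np; rewrite mcoeffB mcoeffU eqxx raddf_sum /= => /eqP.
rewrite subr_eq0 => /eqP sum1.
have [i si] : exists i : 'I_(size s), p \in msupp s`_i.
  apply: contrapT => ns; move/eqP: sum1; rewrite big1 ?oner_eq0 // => i _.
  rewrite mcoeffZ mcoeff_outdom ?mulr0 //; apply/negP => si.
  by apply: ns; exists i.
apply: leq_trans (leq_bigmax_seq _ (mem_nth 0 (ltn_ord i)) isT).
exact: leq_bigmax_seq si isT.
Qed.

End PathBound.

(** * Combinatorics of strings and bands *)

Section StringWords.
Variables (K : closedFieldType) (A : string_algebra K).
Local Notation syl := (syl A).
Implicit Types (u v w z t : seq syl) (x y : syl).

Definition composable x y : bool := (ssrc x == stgt y) && (x != syl_inv y).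

Lemma syl_invK : involutive (@syl_inv K A).
Proof. by case=> a b; rewrite /syl_inv /= negbK. Qed.

Lemma word_invK : involutive (@word_inv K A).
Proof. by move=> w; rewrite /word_inv map_rev revK mapK //; exact: syl_invK. Qed.

Lemma infix_word_inv u v : infix u v -> infix (word_inv u) (word_inv v).
Proof.
case/infixP=> p [q ->]; rewrite /word_inv !map_cat !rev_cat.
apply/infixP; exists (rev (map (@syl_inv K A) q)), (rev (map (@syl_inv K A) p)).
by rewrite catA.
Qed.

Lemma string_infix u w : infix u w -> u != [::] -> string_word w -> string_word u.
Proof.
move=> uw /eqP u0 [_ sw rw]; split=> // [|p /rw[n1 n2]].
  by case/infixP: uw sw => p [q ->] /cat_sorted2[_ /cat_sorted2[]].
by split; [apply: contra n1 | apply: contra n2] => /infix_trans; apply.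
Qed.

Lemma string_inv w : string_word w -> string_word (word_inv w).
Proof.
move=> [w0 sw rw]; split=> [e|| p /rw[n1 n2]].
- by apply: w0; rewrite -[w]word_invK e.
- rewrite rev_sorted sorted_map; apply: sub_sorted sw => -[a i] [b j].
  rewrite /relpre /composable /ssrc /stgt /syl_inv /= !xpair_eqE /= [b == a]eq_sym.
  by case: i; case: j => /=; rewrite ?andbT ?andbF // eq_sym.
- split; first by apply: contra n2 => /infix_word_inv; rewrite word_invK.
  by apply: contra n1 => /infix_word_inv; rewrite !word_invK.
Qed.

Lemma direct_walk x w : path composable x w -> all (@is_direct K A) (x :: w) ->
  exists v : vert A, is_walk v [seq y.1 | y <- x :: w].
Proof.
elim: w x => [|y w IHw] x /=.
  by move=> _ _; exists (src x.1); rewrite eqxx.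
case/andP=> /andP[xy _] yw /andP[dx dyw]; have [v vP] := IHw y yw dyw.
exists v; rewrite {1}/walk_tgt /= in vP *; rewrite vP andbT.
move: xy dx dyw; rewrite /ssrc /stgt /is_direct => xy dx /andP[dy _].
by rewrite dx dy in xy.
Qed.

Lemma infix_map (T T' : eqType) (f : T -> T') (s1 s2 : seq T) :
  infix s1 s2 -> infix (map f s1) (map f s2).
Proof.
case/infixP=> p [q ->]; rewrite !map_cat.
by apply/infixP; exists (map f p), (map f q).
Qed.

Definition one_sided_bound (N : nat) : Prop :=
  forall w r, string_word w -> infix r w ->
    all (@is_direct K A) r \/ all (@is_inverse K A) r -> size r <= N.

(** A direct run is a path without zero relation; an inverse run is the inverse of
    such a path. *)
Lemma string_run_bound : exists N, one_sided_bound N.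
Proof.
have [N bN] := nonzero_path_bound (sa_findim A); exists N.
have direct r : string_word r -> all (@is_direct K A) r -> size r <= N.
  move=> [r0 sr rr] dr; case: r r0 sr rr dr => // x r _ sr rr dr.
  have [v vP] := direct_walk sr dr.
  have := bN (exist _ (v, map fst (x :: r)) vP); rewrite /parr [size _]size_map.
  apply=> -[p /rr[np _] pr]; move/negP: np; apply.
  have := infix_map (fun a => (a, true)) (pr : infix (parr p) (map fst (x :: r))).
  rewrite -map_comp map_id_in // => -[a i] /(allP dr).
  by rewrite /is_direct /= => ->.
move=> w r sw rw; case: (eqVneq r [::]) => [->//|r0].
have sr := string_infix rw r0 sw.
case=> [/(direct _ sr) //|ir].
have := direct _ (string_inv sr); rewrite size_rev size_map; apply.
by rewrite all_rev all_map; apply: sub_all ir => x.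
Qed.

Lemma cat_split (T : Type) (a b c d : seq T) : a ++ b = c ++ d -> size a <= size c ->
  exists e, c = a ++ e /\ b = e ++ d.
Proof.
elim: a c => [|x a IHa] [|y c] //=; first by move=> ->; exists [::].
  by move=> ->; exists (y :: c).
by move=> [-> abcd] ac; have [e [-> ->]] := IHa _ abcd ac; exists e.
Qed.

(** This reduces relations in a long word to relations in two overlapping windows. *)
Lemma infix_overlap (T : eqType) (s z t t2 : seq T) : infix s (z ++ t ++ t2) ->
  [\/ infix s (z ++ t), infix s (t ++ t2) | infix t s].
Proof.
case/infixP=> p [q e]; have [zp|pz] := leqP (size z) (size p).
  have [p' [_ ->]] := cat_split e zp.
  by apply: Or32; apply: infix_catl; apply: prefix_infix.
have [z' [-> e']] := cat_split (esym e) (ltnW pz).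
rewrite catA in e'; have [st|ts] := leqP (size s) (size (z' ++ t)).
  have [s' [zt _]] := cat_split e' st.
  by apply: Or31; rewrite -catA zt; apply: infix_catl; apply: prefix_infix.
have [s' [-> _]] := cat_split (esym e') (ltnW ts).
by apply: Or33; rewrite -catA; apply: infix_catl; apply: prefix_infix.
Qed.

(** A relation occurring in the glued word but in neither piece would contain the
    overlap [t], and be a one-sided run that is too long. *)
Lemma string_glue N z t t2 :
  one_sided_bound N -> N < size t -> string_word (z ++ t) -> string_word (t ++ t2) ->
  string_word (z ++ t ++ t2).
Proof.
move=> bN Nt szt stt2; have [_ sort_zt r_zt] := szt; have [n0 sort_tt2 r_tt2] := stt2.
have t_one_sided s : infix t s ->
    all (@is_direct K A) s \/ all (@is_inverse K A) s -> False.
  move=> /mem_infix ts ds; move: Nt; rewrite ltnNge => /negP; apply.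
  apply: (bN (t ++ t2)) => //; first exact: prefix_infix.
  by case: ds => /allP ds; [left|right]; apply/allP => x /ts /ds.
split.
- by case: (z) => //; case: (t) Nt.
- case: t Nt {szt stt2 r_zt r_tt2 n0 t_one_sided} sort_zt sort_tt2 => // b t _.
  by rewrite cat_cons !sorted_cat_cons => /andP[-> _].
- move=> p rp; have [n1 n2] := r_zt _ rp; have [n3 n4] := r_tt2 _ rp.
  split; apply/negP => /infix_overlap[h|h|/t_one_sided]; try by
    [rewrite h in n1 | rewrite h in n2 | rewrite h in n3 | rewrite h in n4].
    by apply; left; rewrite all_map; apply/allP.
  by apply; right; rewrite all_rev !all_map; apply/allP.
Qed.

(** The last [N + 1] syllables added form an overlap longer than any one-sided run,
    so [string_glue] applies. *)
Lemma string_window N z w :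
  one_sided_bound N -> string_word w ->
  string_word (z ++ w) <-> string_word (z ++ take N.+1 w).
Proof.
move=> bN sw; have [wN|Nw] := leqP (size w) N.+1; first by rewrite take_oversize.
have tw : size (take N.+1 w) = N.+1 by rewrite size_takel // ltnW.
split=> [szw|szt].
  apply: string_infix szw; last by case: (z) => //; case: (take _ _) tw.
  by rewrite -{2}[w](cat_take_drop N.+1) catA prefix_infix.
by rewrite -[w](cat_take_drop N.+1); apply: string_glue bN _ szt _;
  rewrite ?tw ?cat_take_drop.
Qed.

Lemma word_pow_mul (T : Type) m n (w : seq T) : wpow n (wpow m w) = wpow (n * m) w.
Proof. by elim: n => //= n ->; rewrite mulSn nseqD flatten_cat. Qed.

Lemma size_pow (T : Type) n (w : seq T) : size (wpow n w) = n * size w.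
Proof. by elim: n => //= n IHn; rewrite size_cat IHn mulSn. Qed.

(** Induction on the length: a proper power is replaced by its base, whose powers
    are factors of powers of the word. *)
Lemma band_root w : (forall n, 1 <= n -> string_word (word_pow n w)) ->
  exists d k, [/\ is_band d, 1 <= k & w = word_pow k d].
Proof.
elim: {w}_.+1 {-2}w (ltnSn (size w)) => // k IHk w wk sw.
have [[c [n [sc n2 wE]]]|prim] :=
    EM (exists c n, [/\ string_word c, 2 <= n & w = word_pow n c]); last first.
  by exists w, 1; split=> //; rewrite /word_pow /= cats0.
have c0 : c != [::] by case: sc => /eqP.
have ck : size c < k.
  apply: leq_trans (_ : size w <= k); last by [].
  by rewrite wE size_pow -[X in X < _]mul1n ltn_pmul2r // lt0n size_eq0.
have [m m1|d [j [bd j1 cE]]] := IHk c ck.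
  apply: string_infix (sw m m1); last first.
    by rewrite -size_eq0 size_pow muln_eq0 size_eq0 negb_or c0 -lt0n m1.
  rewrite wE /word_pow word_pow_mul -(subnKC (_ : m <= m * n)).
    by rewrite nseqD flatten_cat prefix_infix.
  by rewrite leq_pmulr // ltnW.
exists d, (n * j); split=> //; first by rewrite muln_gt0 j1 ltnW.
by rewrite wE cE /word_pow word_pow_mul.
Qed.

Lemma comm_pow (T : Type) (a d : seq T) k : a ++ d = d ++ a ->
  a ++ wpow k d = wpow k d ++ a.
Proof.
move=> ad; elim: k => [|k IHk]; first by rewrite cats0.
by rewrite /= catA ad -!catA IHk.
Qed.

Lemma take_pow_cat (T : Type) n (d b : seq T) i : i <= size (wpow n d) ->
  take i (d ++ wpow n d ++ b) = take i (wpow n d).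
Proof.
move=> il; rewrite catA (_ : d ++ wpow n d = wpow n d ++ d).
  by rewrite -catA takel_cat.
by elim: (n) => [|m IHm] /=; [rewrite cats0 | rewrite {1}IHm catA].
Qed.

(** The word [a^(n+1) b = d^k] starts with a long power of [a] and with a power of
    [d], so it starts with both [a d] and [d a]; these are equal. Then [a]
    commutes with [d^k = a^(n+1) b], hence with [b]. *)
Lemma pow_comm (T : Type) (a b d : seq T) n k : 0 < size a -> size d <= n ->
  a ++ wpow n a ++ b = wpow k d -> a ++ b = b ++ a.
Proof.
move=> a0 dn WE; have k0 : 0 < k.
  by case: k WE => //=; case: (a) a0.
have sz : size a + size d <= size (wpow k d).
  rewrite -WE !size_cat leq_add2l size_pow; apply: leq_trans dn _.
  by apply: leq_trans (leq_addr _ _); rewrite leq_pmulr.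
case: k k0 WE sz => // k _ WE sz; rewrite /= size_cat in sz.
have ak : size a <= size (wpow k d) by rewrite addnC leq_add2l in sz.
have dk : size d <= size (wpow n a).
  by rewrite size_pow; apply: leq_trans dn _; rewrite leq_pmulr.
have dE : take (size d) (wpow n a) = d.
  by rewrite -(take_pow_cat b dk) WE /= take_size_cat.
have aE : take (size a) (wpow k d) = a.
  have := take_pow_cat [::] ak; rewrite cats0 => <-.
  by rewrite -[d ++ _]/(wpow k.+1 d) -WE take_size_cat.
have ad : a ++ d = d ++ a.
  have := cat_take_drop (size d) (wpow n a ++ b); rewrite takel_cat // dE => W1E.
  have := cat_take_drop (size a) (wpow k d); rewrite aE => W2E.
  have := congr1 (take (size a + size d)) WE; rewrite /= -W1E -W2E !catA.
  by rewrite take_size_cat ?size_cat // take_size_cat // size_cat addnC.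
have := comm_pow k.+1 ad; rewrite -WE -!catA => /(congr1 (drop (size a))).
rewrite !drop_size_cat // catA (comm_pow n (erefl (a ++ a))) -catA.
move=> /(congr1 (drop (size (wpow n a)))).
by rewrite !drop_size_cat.
Qed.

(** The primitive root of [a^(n+1) b] is a rotation of one of finitely many bands,
    so its length is at most [n] once [n] is chosen large. *)
Lemma domestic_commute (a b : seq syl) : domestic A -> a != [::] ->
  (forall n m, 1 <= m -> string_word (word_pow m (word_pow n a ++ b))) ->
  a ++ b = b ++ a.
Proof.
move=> [s sP] a0 sab; pose n := \max_(c <- s) size c.
have [d [k [bd _ dE]]] := band_root (sab n.+1).
have [c cs [i dc]] := sP d bd.
apply: (pow_comm (d := d) (n := n) (k := k)); first by rewrite lt0n size_eq0.
  by rewrite dc size_rot; apply: leq_bigmax_seq cs isT.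
by rewrite -[RHS]dE /word_pow /= catA.
Qed.

End StringWords.

Lemma cat_injr (T : Type) (s a b : seq T) : a ++ s = b ++ s -> a = b.
Proof.
move=> /(congr1 rev); rewrite !rev_cat => /(congr1 (drop (size (rev s)))).
by rewrite !drop_size_cat // => /(can_inj revK).
Qed.

(** * The hammock as a binary tree *)

Section HammockTree.
Variables (K : closedFieldType) (A : string_algebra K) (S : sign_functions A).
Variable x0 : raw_string A.
Hypothesis x0_string : is_string x0.
Local Notation syl := (syl A).
Local Notation up := (@is_inverse K A).
Implicit Types (u v w z : seq syl) (x y : syl).

Definition base : seq syl := if x0 is Word w then w else [::].

(** Strings are stored with their first syllable last, whereas trees read words
    from the root; hence the reversal. *)
Definition extend u : raw_string A :=
  match x0, u with
  | Lazy _ _, [::] => x0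
  | _, _ => Word (rev u ++ base)
  end.

Definition starts_well u : Prop :=
  match x0, u with
  | Lazy v j, x :: _ => ssrc x = v /\ sgn_syl S x = ~~ j
  | _, _ => True
  end.

Definition ext_tree u : Prop :=
  u = [::] \/ string_word (rev u ++ base) /\ starts_well u.

Lemma ext_tree_string u : ext_tree u -> u != [::] -> string_word (rev u ++ base).
Proof. by case=> [->|[]]. Qed.

Lemma extend_nil : extend [::] = x0.
Proof. by rewrite /extend /base; case: x0. Qed.

Lemma extend_string u : ext_tree u -> is_string (extend u).
Proof.
case=> [->|[su _]]; first by rewrite extend_nil.
by move: su; rewrite /extend; case: x0 => [v j|w]; case: u.
Qed.

Lemma is_cat_extend u v z : ext_tree v ->
  is_cat S z (extend u) (extend v) <-> v = u ++ rev z.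
Proof.
have revE a b : rev b = z ++ rev a <-> b = a ++ rev z.
  by split=> [/(congr1 rev)|->]; rewrite ?rev_cat !revK.
rewrite /ext_tree /starts_well /extend /base; case: x0 x0_string => [c j|w] sx Pv /=.
  case: u v Pv => [|a u] [|b v] Pv /=; rewrite ?cats0.
  - split=> [[-> //]|e]; split=> //.
    by apply: (can_inj revK); rewrite -e.
  - case: Pv => [//|[_ [bc bj]]]; split=> [[<- _]|bE]; first by rewrite revK.
    rewrite bE revK; split=> //; exists (rev v), b; split=> //.
    by rewrite -rev_cons bE revK.
  - by split.
  - by have <- := revE (a :: u) (b :: v); split=> [[]|->].
by rewrite /= -revE catA; split=> [[/cat_injr]|->].
Qed.

Definition strip (y : raw_string A) : seq syl :=
  if y is Word w then rev (take (size w - size base) w) else [::].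

Lemma extendK : cancel extend strip.
Proof.
move=> u; rewrite /extend /strip /base.
case: x0 => [c j|w]; last by rewrite size_cat addnK take_size_cat ?revK.
by case: u => // a u; rewrite cats0 subn0 take_size revK.
Qed.

Lemma extend_inj : injective extend.
Proof. exact: can_inj extendK. Qed.

Lemma hammockP (y : raw_string A) :
  hammock S x0 y <-> exists2 u, ext_tree u & y = extend u.
Proof.
split=> [[sy [z zy]]|[u Pu ->]]; last first.
  split; first exact: extend_string.
  by exists (rev u); rewrite -{1}extend_nil is_cat_extend ?revK.
exists (rev z).
  move: x0_string sy zy; rewrite /ext_tree /base /starts_well.
  case: x0 => [c j|w]; case: y => [c' j'|w'] //= s0 sy.
  - by case=> -> _ _; left.
  - move=> [wE [t [a [zE ac aj]]]]; right; rewrite revK cats0 zE rev_rcons.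
    by split=> //; rewrite -zE -wE.
  - by move=> wE; right; rewrite revK -wE.
move: x0_string sy zy; rewrite /extend /base.
case: x0 => [c j|w]; case: y => [c' j'|w'] //= s0 sy.
- by case=> -> -> ->.
- by move=> [-> [t [a [-> _ _]]]]; rewrite rev_rcons cats0 /= -rev_rcons revK.
- by move=> ->; rewrite revK.
Qed.

(** With the sign of [sgn_syl] as the sign at the start of a syllable, this is its
    sign at the end. *)
Definition ending_sign x : bool := if x.2 then eps S x.1 else sgn S x.1.

(** This unifies the three axioms on signs: consecutive syllables form a path, an
    inverse path, or two arrows with the same source or the same target. *)
Lemma sgn_next x y w : string_word [:: x, y & w] -> sgn_syl S x = ~~ ending_sign y.
Proof.
move=> [_ + rw]; case: x y rw => [a i] [b j] rw.
have {}rw p : sa_rel p -> ~ prefix (direct_word p) [:: (a, i), (b, j) & w] /\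
    ~ prefix (word_inv (direct_word p)) [:: (a, i), (b, j) & w].
  by move=> /rw[n1 n2]; split=> /prefixW; apply/negP.
rewrite /ssrc /stgt /syl_inv /sgn_syl /ending_sign /= xpair_eqE.
move=> /andP[/andP[/eqP ab nab] _].
case: i j ab nab rw => -[] /= ab; rewrite ?andbT => nab rw.
- have wk : is_walk (src b) [:: a; b] by rewrite /= ab !eqxx.
  apply: (@sgn_eps _ _ S a b (exist _ (src b, [:: a; b]) wk)) => // /rw[n _].
  by apply: n; rewrite /= !eqxx prefix0s.
- by apply: sgn_src => //; apply/eqP.
- by apply: eps_tgt => //; apply/eqP.
have wk : is_walk (src a) [:: b; a] by rewrite /= ab !eqxx.
rewrite (@sgn_eps _ _ S b a (exist _ (src a, [:: b; a]) wk)) ?negbK // => /rw[_ n].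
by apply: n; rewrite /= !eqxx prefix0s.
Qed.

Lemma syl_eq x y : ssrc x = ssrc y -> sgn_syl S x = sgn_syl S y -> up x = up y -> x = y.
Proof.
case: x => a i; case: y => b j; rewrite /ssrc /sgn_syl /is_inverse /=.
move=> st sg /negb_inj ij; subst j; have [->//|/eqP ab] := eqVneq a b.
by case: i st sg => [/(sgn_src S ab)|/(eps_tgt S ab)] -> /esym/eqP; case: (_ S b).
Qed.

(** The preceding syllable, or the sign of a string of length zero, prescribes the
    start and the sign of the next syllable, leaving one arrow for each
    direction. *)
Lemma ext_tree_binary : binary_tree up ext_tree.
Proof.
split=> [u v|u x y].
  have [->|u0] := eqVneq u [::]; first by left.
  case=> [e|[suv wuv]]; first by case: (u) u0 e.
  right; split.
    apply: string_infix suv; first by rewrite rev_cat -catA suffix_infix.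
    by rewrite -size_eq0 size_cat size_rev addn_eq0 size_eq0 negb_and u0.
  by move: wuv; rewrite /starts_well; case: x0 => // c j; case: (u) u0.
case=> [e|[sx wx]]; first by case: (u) e.
case=> [e|[sy wy]]; first by case: (u) e.
rewrite !rev_rcons !cat_cons in sx sy.
case wE: (rev u ++ base) sx sy => [|b w] sx sy.
  have uE : u = [::] by apply/eqP; rewrite -size_eq0 -size_rev; case: (rev u) wE.
  move: wE wx wy x0_string; rewrite uE /= /base /starts_well.
  case: x0 => [c j _ [<- xj] [yc yj] _|w -> _ _ [//]].
  by apply: syl_eq; rewrite ?xj ?yj.
have [_ /= /andP[/andP[/eqP xb _] _] _] := sx.
have [_ /= /andP[/andP[/eqP yb _] _] _] := sy.
by apply: syl_eq; rewrite ?xb ?yb // (sgn_next sx) (sgn_next sy).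
Qed.

Lemma ext_tree_runs N :
  one_sided_bound A N ->
  bounded_runs up ext_tree /\ bounded_runs (fun x => ~~ up x) ext_tree.
Proof.
move=> bN; have run w r : ext_tree (w ++ r) ->
    all (@is_direct K A) r \/ all up r -> size r <= N.
  have [->//|r0] := eqVneq r [::].
  case=> [e|[swr _]]; first by case: (w) e r0 => //= ->.
  rewrite -(size_rev r) -!(all_rev _ r); apply: bN swr _.
  by rewrite rev_cat -catA prefix_infix.
split; exists N => w r Pwr ar; apply: run Pwr _; [by right | left].
by apply: sub_all ar => x /negPn.
Qed.

Lemma size_take_le n w : size (take n w) <= n.
Proof. by rewrite size_take_min geq_minl. Qed.

(** A residual is determined by the last [N + 1] syllables. The root is kept apart:
    for a string of length zero its extensions are also constrained by a sign. *)
Definition state N u : option (N.+1.-bseq (arr A * bool)%type) :=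
  if u is [::] then None else Some (Bseq (size_take_le N.+1 (rev u ++ base))).

Lemma state_residual N :
  one_sided_bound A N ->
  forall w w', ext_tree w -> ext_tree w' -> state N w = state N w' ->
    forall u, ext_tree (w ++ u) <-> ext_tree (w' ++ u).
Proof.
move=> bN; suff half w w' u : ext_tree w -> ext_tree w' -> state N w = state N w' ->
    ext_tree (w ++ u) -> ext_tree (w' ++ u).
  by move=> w w' Pw Pw' e u; split; apply: half.
case: w w' => [|a w] [|b w'] // [//|[sw ww]] [//|[sw' ww']] [tE] [//|[swu _]].
right; split; last by move: ww'; rewrite /starts_well; case: x0.
move: swu; rewrite !rev_cat -!catA (string_window _ bN sw) (string_window _ bN sw').
by rewrite tE.
Qed.

(** Return words can be concatenated freely, so all powers of [c' c^n] extend [w]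
    and are strings. *)
Lemma ext_tree_commute : domestic A ->
  forall w c c', ext_tree w -> c != [::] -> c' != [::] ->
    ext_tree (w ++ c) -> ext_tree (w ++ c') ->
    (forall u, ext_tree (w ++ c ++ u) <-> ext_tree (w ++ u)) ->
    (forall u, ext_tree (w ++ c' ++ u) <-> ext_tree (w ++ u)) ->
    c ++ c' = c' ++ c.
Proof.
move=> domA w c c' Pw c0 c'0 Pc Pc' cP c'P.
have rev0 u : u != [::] -> rev u != [::] by rewrite -!size_eq0 size_rev.
have rev_pow n u : rev (word_pow n u) = word_pow n (rev u).
  elim: n => // n IHn; rewrite /word_pow /= rev_cat -/(word_pow n u) IHn /word_pow.
  by elim: n {IHn} => [|n IHn] /=; [rewrite cats0 | rewrite -catA IHn].
apply: (can_inj revK); rewrite !rev_cat; symmetry.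
apply: domestic_commute domA (rev0 _ c0) _ => n m m1.
rewrite -rev_pow -rev_cat -rev_pow; set t := c' ++ _.
have powP k v u : (forall u', ext_tree (w ++ v ++ u') <-> ext_tree (w ++ u')) ->
    ext_tree (w ++ word_pow k v ++ u) <-> ext_tree (w ++ u).
  by move=> vP; elim: k => // k IHk; rewrite /word_pow /= -catA vP.
have tP u : ext_tree (w ++ t ++ u) <-> ext_tree (w ++ u).
  by rewrite /t -catA c'P powP.
have Pt : ext_tree (w ++ word_pow m t).
  by rewrite -[word_pow m t]cats0 powP // cats0.
have t0 : word_pow m t != [::].
  case: (m) m1 => // k _; rewrite /t /word_pow /=.
  by case: (c') c'0.
apply: string_infix (ext_tree_string Pt _); last by case: (w); case: (word_pow m t) t0.
- by rewrite rev_cat -catA prefix_infix.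
- exact: rev0.
Qed.

Lemma hammock_lt_inorder u v : ext_tree u -> ext_tree v ->
  hammock_lt S x0 (extend u) (extend v) <-> inorder up u v.
Proof.
move=> Pu Pv; have [Pp _] := ext_tree_binary; split=> [[_ h]|uv].
  apply/inorderP; case: h => [[z [a [ia /(is_cat_extend _ _ Pv) ->]]]||].
  - by apply: Or31; exists a => //; exists (rev z); rewrite rev_rcons.
  - move=> [z [b [db /(is_cat_extend _ _ Pu) ->]]].
    by apply: Or32; exists b; rewrite ?negbK //; exists (rev z); rewrite rev_rcons.
  move=> [_ [z [z' [b [a [/hammockP[c Pc ->] db ia]]]]]].
  move=> /(is_cat_extend _ _ Pu) -> /(is_cat_extend _ _ Pv) ->.
  apply: Or33; exists c, b, a, (rev z), (rev z').
  by rewrite !rev_rcons negbK.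
split=> [/extend_inj e|]; first by rewrite e in uv; apply: inorder_irr uv.
case/inorderP: uv => [[a ia [r vE]]|[b db [r uE]]|[c [b [a [r [s [db ia uE vE]]]]]]].
- by apply: Or31; exists (rev r), a; rewrite is_cat_extend // rev_rcons revK.
- apply: Or32; exists (rev r), b; rewrite is_cat_extend // rev_rcons revK.
  by move/negPn: db.
apply: Or33; exists (extend c), (rev r), (rev s), b, a.
split=> //; last 2 first.
- by rewrite is_cat_extend // rev_rcons revK.
- by rewrite is_cat_extend // rev_rcons revK.
- by apply/hammockP; exists c => //; apply: (Pp _ (b :: r)); rewrite -uE.
- exact/negPn.
Qed.

Lemma string_length_extend u : string_length (extend u) = size u + size base.
Proof.
by rewrite /extend /base; case: x0 => [c j|w]; case: u => [|a u] //=;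
  rewrite size_cat size_rev.
Qed.

Lemma one_sided_extP i m : one_sided_ext S x0 i m <->
  exists u, [/\ ext_tree u, all (fun x => up x == i) u & m = extend u].
Proof.
have dirE z : all (if i then up else @is_direct K A) z = all (fun x => up x == i) (rev z).
  rewrite all_rev; apply: eq_all => x.
  by case: i; rewrite /is_inverse /is_direct; case: x.2.
split=> [[sm [z zm az]]|[u [Pu au ->]]].
  have /hammockP[u Pu mE] : hammock S x0 m by split=> //; exists z.
  exists u; split=> //; subst m.
  by move: zm; rewrite -{1}extend_nil is_cat_extend // => ->; rewrite -dirE.
split; first exact: extend_string.
by exists (rev u); rewrite ?dirE ?revK // -{1}extend_nil is_cat_extend ?revK.
Qed.

(** A one-sided extension that cannot be prolonged is the longest one, since the
    one-sided extensions form a chain. *)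
Lemma extremal_extend i r : ext_tree r -> all (fun x => up x == i) r ->
  (forall x, up x == i -> ~ ext_tree (rcons r x)) -> extremal S x0 i (extend r).
Proof.
move=> Pr ar rmax; split; first by apply/one_sided_extP; exists r.
move=> _ /one_sided_extP[u [Pu au ->]]; rewrite !string_length_extend leq_add2r.
have tP : binary_tree (fun x => up x == i) ext_tree.
  case: ext_tree_binary => Pp Pd; split=> // u' x y Px Py xy; apply: Pd Px Py _.
  by case: (i) xy; case: (up x); case: (up y).
have [->//|/inorderP] := inorder_max tP Pr ar rmax Pu.
case=> [[x _ [s ->]]|[x ux [s uE]]|[c [x [y [s [s' [ux _ uE _]]]]]]].
- by rewrite size_cat leq_addr.
- by move: au; rewrite uE all_cat /= (negPf ux) andbF.
- by move: au; rewrite uE all_cat /= (negPf ux) andbF.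
Qed.

Lemma hammock_le_inorder u v : ext_tree u -> ext_tree v ->
  hammock_le S x0 (extend u) (extend v) <-> u = v \/ inorder up u v.
Proof.
move=> Pu Pv; rewrite /hammock_le hammock_lt_inorder //.
by split=> [[/extend_inj|]|[->|]]; [left|right|left|right].
Qed.

Lemma hammock_sideP i (y : raw_string A) :
  hammock_side S x0 i y <-> exists2 u, half_tree up ext_tree i u & y = extend u.
Proof.
have P0 : ext_tree [::] by left.
have tP := ext_tree_binary.
have rootE u : ext_tree u -> (if i then hammock_le S x0 (extend [::]) (extend u)
    else hammock_le S x0 (extend u) (extend [::])) <-> half_tree up ext_tree i u.
  move=> Pu; rewrite /half_tree; case: i; rewrite hammock_le_inorder //.
    case: u Pu => [|x u] Pu /=; split=> [h|[_ /eqP ux]]; [by []|by left| |by right].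
    by split=> //; case: h => // ->.
  case: u Pu => [|x u] Pu /=; split=> [h|[_ /eqP ux]]; [by []|by left| |].
    by split=> //; case: h => // /negPf ->.
  by right; rewrite ux.
split=> [[/hammockP[u Pu ->] [m _ h]]|[u hu ->]].
  exists u => //; apply/rootE => //; rewrite extend_nil.
  by case: (i) h => -[].
have [Pu _] := hu; split; first by apply/hammockP; exists u.
have [N /ext_tree_runs[runs_up runs_down]] := string_run_bound A.
have upE : (fun x => up x == i) = if i then up else fun x => ~~ up x.
  by apply: funext => x; case: (i); case: (up x).
have runs : bounded_runs (fun x => up x == i) ext_tree by rewrite upE; case: (i).
have [r [ar /= Pr rmax]] := maximal_run runs P0.
exists (extend r); first exact: extremal_extend.
have := (rootE u Pu).2 hu; rewrite extend_nil.
have {}rmax x : (if i then up else fun x => ~~ up x) x -> ~ ext_tree (rcons r x).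
  by rewrite -upE; apply: rmax.
rewrite upE in ar; move: ar rmax; case: (i) => ar rmax h; split=> //.
  by apply/hammock_le_inorder => //; have := inorder_max tP Pr ar rmax Pu.
apply/hammock_le_inorder => //.
have [->|] := inorder_max (binary_tree_dual tP) Pr ar rmax Pu; first by left.
by rewrite inorder_dual; right.
Qed.

Lemma realizes_hammock_side i :
  realizes (inorder up) (@hammock_side_lt K A S x0 i) (half_tree up ext_tree i).
Proof.
exists (fun h : hammock_side_type S x0 i => strip (sval h)); split.
- move=> [y hy] [y' hy'] /= e; apply: eq_exist.
  have /hammock_sideP[u _ yE] := hy; have /hammock_sideP[u' _ yE'] := hy'.
  by rewrite yE yE' !extendK in e *; rewrite e.
- move=> [y hy] [y' hy']; rewrite /hammock_side_lt /=.
  have /hammock_sideP[u [Pu _] ->] := hy; have /hammock_sideP[u' [Pu' _] ->] := hy'.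
  by rewrite !extendK hammock_lt_inorder.
- move=> u; split=> [hu|[[y /= /hammock_sideP[u' hu' ->]] <-]]; last by rewrite extendK.
  have hy : hammock_side S x0 i (extend u) by apply/hammock_sideP; exists u.
  by exists (exist _ _ hy); rewrite /= extendK.
Qed.

End HammockTree.

Theorem corollary10p14 (K : closedFieldType) (A : string_algebra K)
    (S : sign_functions A) (x0 : raw_string A) (i : bool) :
  domestic A -> is_string x0 -> dLOfpb (@hammock_side_lt K A S x0 i).
Proof.
move=> domA sx0; have [N bN] := string_run_bound A.
have [runs_up runs_down] := ext_tree_runs S x0 bN.
apply: dLOfpb_half_tree (realizes_hammock_side S sx0 i) => //.
- exact: ext_tree_binary.
- by left.
- exact: state_residual bN.
- exact: ext_tree_commute.
Qed.
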